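(* Let $\mathcal{H}$ be a complex Hilbert space, let $A\in\mathcal{B}(\mathcal{H})$ be a nonzero positive semidefinite operator, let $\mathbb{A}=\begin{pmatrix}A&O\\O&A\end{pmatrix}$ on $\mathcal{H}\oplus\mathcal{H}$, let $X\in\mathcal{B}_{A^{1/2}}(\mathcal{H})$, and let $\mathbb{T}=\begin{pmatrix}I&X\\O&O\end{pmatrix}$. Then $$dw_{\mathbb{A}}(\mathbb{T})=\begin{cases}\sqrt2, & \|X\|_A=0,\\ (\cos\theta_0+\|X\|_A\sin\theta_0)\left(\cos^2\theta_0+(\cos\theta_0+\|X\|_A\sin\theta_0)^2\right)^{1/2}, & \|X\|_A\neq0,\end{cases}$$ where, in the case $\|X\|_A\ne 0$, $b=\|X\|_A$, $p=-\frac{2b^2-5}{2b}$, $q=-\frac{2b^2-2}{b^2}$, $r=-\frac{3}{2b}$, $s=\frac{1}{2^4 3^3 b^6}\left(8b^8+20b^6+45b^4+61b^2+28\right)$, $\alpha=\frac1{27}(2p^3-9pq+27r)$, $\beta=\left(-\frac{\alpha}{2}+\sqrt{s}\right)^{1/3}$, $\gamma=\left(-\frac{\alpha}{2}-\sqrt{s}\right)^{1/3}$ and $\theta_0=\tan^{-1}\left(\beta+\gamma-\frac p3\right)$.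
   Context: $\mathcal{B}(\mathcal{H})$ is the algebra of bounded linear operators on the complex Hilbert space $\mathcal{H}$; $I$ and $O$ are the identity and zero operators. For a positive semidefinite $A\in\mathcal{B}(\mathcal{H})$, put $\langle x,y\rangle_A=\langle Ax,y\rangle$ and $\|x\|_A=\sqrt{\langle x,x\rangle_A}$. $\mathcal{B}_{A^{1/2}}(\mathcal{H})$ is the set of $T\in\mathcal{B}(\mathcal{H})$ that are $A$-bounded: there is $c>0$ with $\|Tx\|_A\le c\|x\|_A$ for all $x\in\mathcal{H}$. For such $T$: $\|T\|_A=\sup\{\|Tx\|_A:x\in\mathcal{H},\|x\|_A=1\}$ and $dw_A(T)=\sup\{\sqrt{|\langle Tx,x\rangle_A|^2+\|Tx\|_A^4}:x\in\mathcal{H},\|x\|_A=1\}$. $dw_{\mathbb{A}}$ is defined in the same way for $\mathbb{A}$-bounded operators on the Hilbert space $\mathcal{H}\oplus\mathcal{H}$ with the positive operator $\mathbb{A}$ in place of $A$. Cube roots are real cube roots of real numbers, and $\tan^{-1}$ takes values in $(-\pi/2,\pi/2)$. *)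

(* Defs.v *)
From HB Require Import structures.
From mathcomp Require Import all_boot all_order all_algebra.
From mathcomp Require Import sesquilinear complex.
From mathcomp Require Import all_classical all_reals all_analysis.
From mathcomp Require Import ring.

Set Implicit Arguments.
Unset Strict Implicit.
Unset Printing Implicit Defensive.
Import Order.TTheory GRing.Theory Num.Theory.

Local Open Scope classical_set_scope.
Local Open Scope ring_scope.

(* [{dot H for Num.conj}] is linear in its first argument and conjugate linear
   in its second one. *)
HB.mixin Record NormedModule_isHilbert (R : realType) H
    & CompleteNormedModule R[i] H := {
  inner : {dot H for Num.conj};
  norm_inner : forall x : H, `|x| ^+ 2 = inner x x
}.

#[short(type="hilbertType")]
HB.structure Definition Hilbert (R : realType) :=
  {H of CompleteNormedModule R[i] H & NormedModule_isHilbert R H}.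

Notation "⟨ x , y ⟩" := (inner x y)
  (at level 0, x at level 99, y at level 99, format "⟨ x ,  y ⟩") : ring_scope.

(* The product [H * K] already carries the (max) product norm of the library,
   so the Hilbert direct sum is built on an alias of it. *)
Definition hsum (R : realType) (H K : hilbertType R) : Type := (H * K)%type.
Notation "H ⊕ K" := (hsum H K) (at level 50, left associativity) : type_scope.

Section DirectSum.
Variables (R : realType) (H K : hilbertType R).
Local Notation C := R[i].

HB.instance Definition _ := GRing.Lmodule.copy (hsum H K) (H * K)%type.

Implicit Types u v w : hsum H K.

Definition hsum_inner u v : C := ⟨u.1, v.1⟩ + ⟨u.2, v.2⟩.

Lemma hsum_inner_bilinear : bilinear_for *%R (Num.conj \; *%R) hsum_inner.
Proof.
split=> u a v w; rewrite /hsum_inner /=.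
  by rewrite !linearPl mulrDr addrACA.
by rewrite !linearPr /= mulrDr addrACA.
Qed.

HB.instance Definition _ := @bilinear_isBilinear.Build C (hsum H K) (hsum H K) C
  *%R (Num.conj \; *%R) hsum_inner hsum_inner_bilinear.

Lemma hsum_inner_herm u v :
  hsum_inner u v = (-1) ^+ false * Num.conj (hsum_inner v u).
Proof.
rewrite expr0 mul1r /hsum_inner rmorphD /=; congr (_ + _).
  by rewrite hermC expr0 mul1r.
by rewrite hermC expr0 mul1r.
Qed.

HB.instance Definition _ := @isHermitianSesquilinear.Build C (hsum H K) false
  Num.conj hsum_inner hsum_inner_herm.

Lemma hsum_inner_gt0 u : u != 0 -> 0 < hsum_inner u u.
Proof.
move=> u0; rewrite /hsum_inner lt_def addr_ge0 ?dnorm_ge0// andbT.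
rewrite paddr_eq0 ?dnorm_ge0// !dnorm_eq0; apply: contraNN u0.
by case: u => x y /= /andP[/eqP-> /eqP->].
Qed.

HB.instance Definition _ := @isDotProduct.Build C (hsum H K)
  hsum_inner hsum_inner_gt0.


Definition hsum_norm u : C := sqrtC (hsum_inner u u).

Lemma hsum_normE u : hsum_norm u = sqrtC (`|u.1| ^+ 2 + `|u.2| ^+ 2).
Proof. by rewrite /hsum_norm /hsum_inner !norm_inner. Qed.

Lemma l2_triangle (a b c d : C) : 0 <= a -> 0 <= b -> 0 <= c -> 0 <= d ->
  sqrtC ((a + c) ^+ 2 + (b + d) ^+ 2) <=
  sqrtC (a ^+ 2 + b ^+ 2) + sqrtC (c ^+ 2 + d ^+ 2).
Proof.
move=> a0 b0 c0 d0.
have sq0 (x y : C) : 0 <= x -> 0 <= y -> 0 <= x ^+ 2 + y ^+ 2.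
  by move=> x0 y0; rewrite addr_ge0// exprn_ge0.
have ad0 : 0 <= a * d by exact: mulr_ge0.
have bc0 : 0 <= b * c by exact: mulr_ge0.
have ac0 : 0 <= a * c by exact: mulr_ge0.
have bd0 : 0 <= b * d by exact: mulr_ge0.
have p0 := sq0 _ _ a0 b0; have q0 := sq0 _ _ c0 d0.
have ac_ge0 := addr_ge0 a0 c0; have bd_ge0 := addr_ge0 b0 d0.
rewrite -ler_sqr ?nnegrE ?addr_ge0 ?sqrtC_ge0 ?sq0//.
rewrite [leRHS]sqrrD !sqrtCK -sqrtCM ?nnegrE//.
suff : a * c + b * d <= sqrtC ((a ^+ 2 + b ^+ 2) * (c ^+ 2 + d ^+ 2)).
  move=> h; have -> : (a + c) ^+ 2 + (b + d) ^+ 2 =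
    a ^+ 2 + b ^+ 2 + (a * c + b * d) *+ 2 + (c ^+ 2 + d ^+ 2) by ring.
  by rewrite lerD2r lerD2l lerMn2r h orbT.
rewrite -ler_sqr ?nnegrE ?addr_ge0 ?sqrtC_ge0 ?mulr_ge0// sqrtCK.
rewrite -subr_ge0.
have -> : (a ^+ 2 + b ^+ 2) * (c ^+ 2 + d ^+ 2) - (a * c + b * d) ^+ 2 =
  (a * d - b * c) ^+ 2 by ring.
by rewrite real_exprn_even_ge0// rpredB// ger0_real.
Qed.

Lemma hsum_ler_normD u v : hsum_norm (u + v) <= hsum_norm u + hsum_norm v.
Proof.
rewrite !hsum_normE; apply: le_trans (l2_triangle _ _ _ _) => //.
have sq0 (x y : C) : 0 <= x -> 0 <= y -> 0 <= x ^+ 2 + y ^+ 2.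
  by move=> x0 y0; rewrite addr_ge0// exprn_ge0.
rewrite ler_sqrtC ?nnegrE ?sq0 ?addr_ge0// lerD// ler_sqr ?nnegrE ?addr_ge0 ?ler_normD//.
Qed.

Lemma hsum_normrZ (a : C) u : hsum_norm (a *: u) = `|a| * hsum_norm u.
Proof.
rewrite !hsum_normE /= !normrZ !exprMn -mulrDr sqrtCM ?nnegrE ?addr_ge0 ?exprn_ge0//.
by rewrite sqrCK.
Qed.

Lemma hsum_normr0_eq0 u : hsum_norm u = 0 -> u = 0.
Proof.
move=> /eqP; rewrite sqrtC_eq0 => u0; apply/eqP; apply: contraTT u0.
by move=> /hsum_inner_gt0; rewrite lt0r => /andP[].
Qed.

HB.instance Definition _ := @Lmodule_isNormed.Build C (hsum H K)
  hsum_norm hsum_ler_normD hsum_normrZ hsum_normr0_eq0.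

Lemma hsum_norm_fst u : `|u.1| <= `|u|.
Proof.
rewrite -[`|u|]/(hsum_norm u) hsum_normE -[leLHS]sqrCK//.
by rewrite ler_sqrtC ?nnegrE ?addr_ge0 ?exprn_ge0// lerDl exprn_ge0.
Qed.

Lemma hsum_norm_snd u : `|u.2| <= `|u|.
Proof.
rewrite -[`|u|]/(hsum_norm u) hsum_normE -[leLHS]sqrCK//.
by rewrite ler_sqrtC ?nnegrE ?addr_ge0 ?exprn_ge0// lerDr exprn_ge0.
Qed.

Lemma hsum_norm_le u : `|u| <= `|u.1| + `|u.2|.
Proof.
rewrite -[`|u|]/(hsum_norm u) hsum_normE -[leRHS]sqrCK ?addr_ge0//.
rewrite ler_sqrtC ?nnegrE ?exprn_ge0 ?addr_ge0 ?exprn_ge0// sqrrD.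
by rewrite lerD2r lerDl mulrn_wge0// mulr_ge0.
Qed.

Lemma hsum_complete (F : set_system (hsum H K)) :
  ProperFilter F -> cauchy F -> cvg F.
Proof.
move=> PF Fc.
have cauchy_comp (L : hilbertType R) (f : hsum H K -> L) :
    (forall u v, `|f u - f v| <= `|u - v|) -> cauchy (f @ F).
  move=> fle; apply: cauchy_exP => e e0.
  have /cauchyP/(_ e e0)[u Fu] := Fc.
  exists (f u); change (F (f @^-1` ball (f u) e)).
  by apply: filterS Fu => v; rewrite -!ball_normE; exact: le_lt_trans.
have /cauchy_cvg/cvg_ex[/= l1 Fl1] : cauchy ((fun u => u.1) @ F).
  by apply: cauchy_comp => u v; exact: (hsum_norm_fst (u - v)).
have /cauchy_cvg/cvg_ex[/= l2 Fl2] : cauchy ((fun u => u.2) @ F).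
  by apply: cauchy_comp => u v; exact: (hsum_norm_snd (u - v)).
apply/cvg_ex; exists ((l1, l2) : hsum H K).
apply/(@cvgrPdist_lt _ _ _ F PF idfun) => e e0.
have e20 : 0 < e / 2 by rewrite divr_gt0.
move/cvgrPdist_lt/(_ _ e20) : Fl1 => Fl1.
move/cvgrPdist_lt/(_ _ e20) : Fl2 => Fl2.
apply: filterS2 Fl1 Fl2 => u u1 u2.
apply: (le_lt_trans (hsum_norm_le _)); rewrite [ltRHS]splitr.
exact: ltrD.
Qed.

HB.instance Definition _ := Uniform_isComplete.Build (hsum H K) hsum_complete.

Lemma hsum_norm_inner u : `|u| ^+ 2 = hsum_inner u u.
Proof. by rewrite -[`|u|]/(hsum_norm u) sqrtCK. Qed.

HB.instance Definition _ := @NormedModule_isHilbert.Build R (hsum H K)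
  (hsum_inner : {dot (hsum H K) for Num.conj}) hsum_norm_inner.

Lemma hsum_innerE u v : ⟨u, v⟩ = ⟨u.1, v.1⟩ + ⟨u.2, v.2⟩.
Proof. by []. Qed.

End DirectSum.

Record bop (R : realType) (H : hilbertType R) := BOp {
  bop_fun :> {linear H -> H};
  bop_bounded : exists M : R[i], forall x, `|bop_fun x| <= M * `|x|
}.

Section Operators.
Variables (R : realType) (H : hilbertType R).

Lemma id_bounded : exists M : R[i], forall x : H, `|idfun x| <= M * `|x|.
Proof. by exists 1 => x; rewrite mul1r. Qed.

Definition bop1 : bop H := BOp id_bounded.

Lemma zero_bounded :
  exists M : R[i], forall x : H, `|(\0 : {linear H -> H}) x| <= M * `|x|.
Proof. by exists 0 => x; rewrite normr0 mul0r. Qed.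

Definition bop0 : bop H := BOp zero_bounded.

Variables A B C D : bop H.

Definition block_fun (u : H ⊕ H) : H ⊕ H :=
  (A u.1 + B u.2, C u.1 + D u.2).

Lemma block_fun_is_linear : linear block_fun.
Proof.
move=> a u v; rewrite /block_fun /= !linearP.
by congr pair => /=; rewrite scalerDr addrACA.
Qed.

HB.instance Definition _ := GRing.isLinear.Build R[i] (H ⊕ H) (H ⊕ H)
  *:%R block_fun block_fun_is_linear.

Lemma block_bounded : exists M : R[i], forall u, `|block_fun u| <= M * `|u|.
Proof.
have bop_ub (T : bop H) : exists2 M, 0 <= M & forall x, `|T x| <= M * `|x|.
  have [M TM] := bop_bounded T; exists `|M| => // x.
  have Mx0 : 0 <= M * `|x| by exact: le_trans (TM x).
  by rewrite (le_trans (TM x))// -(ger0_norm Mx0) normrM normr_id.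
have [a a0 Aa] := bop_ub A; have [b b0 Bb] := bop_ub B.
have [c c0 Cc] := bop_ub C; have [d d0 Dd] := bop_ub D.
exists (a + b + (c + d)) => u; apply: (le_trans (hsum_norm_le _)) => /=.
rewrite mulrDl; apply: lerD; apply: (le_trans (ler_normD _ _)).
  rewrite mulrDl; apply: lerD.
    by apply: (le_trans (Aa _)); rewrite ler_wpM2l// hsum_norm_fst.
  by apply: (le_trans (Bb _)); rewrite ler_wpM2l// hsum_norm_snd.
rewrite mulrDl; apply: lerD.
  by apply: (le_trans (Cc _)); rewrite ler_wpM2l// hsum_norm_fst.
by apply: (le_trans (Dd _)); rewrite ler_wpM2l// hsum_norm_snd.
Qed.

Definition block : bop (H ⊕ H) := BOp block_bounded.

Lemma blockE u : block u = (A u.1 + B u.2, C u.1 + D u.2).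
Proof. by []. Qed.

End Operators.

Arguments bop0 {R H}.
Arguments bop1 {R H}.

Section ASeminorm.
Variables (R : realType) (H : hilbertType R).
Implicit Types (A T : bop H) (x y : H).

(* In [R[i]], [0 <= z] means that [z] is real and nonnegative. *)
Definition positive_semidefinite A := forall x, 0 <= ⟨A x, x⟩.

Definition innerA A x y : R[i] := ⟨A x, y⟩.

Definition normA A x : R := Num.sqrt (complex.Re (innerA A x x)).

Definition A_bounded A T :=
  exists2 c : R, 0 < c & forall x, normA A (T x) <= c * normA A x.

Definition opnormA A T : R :=
  sup [set normA A (T x) | x in [set x | normA A x = 1]].

Definition dw A T : R :=
  sup [set Num.sqrt (complex.Re `|innerA A (T x) x| ^+ 2 + normA A (T x) ^+ 4)
      | x in [set x | normA A x = 1]].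

End ASeminorm.

(* The odd real cube root; [powR] is only meaningful on nonnegative bases. *)
Definition cbrt (R : realType) (x : R) : R := Num.sg x * `|x| `^ 3^-1.

Lemma cbrtK (R : realType) (x : R) : cbrt x ^+ 3 = x.
Proof.
rewrite /cbrt exprMn -(powR_mulrn _ (powR_ge0 _ _)) -powRrM mulVf ?pnatr_eq0//.
rewrite powRr1// exprS sqr_sg mulrAC -numEsg.
by case: eqVneq => [->|x0]; rewrite ?mul0r// mulr1.
Qed.

(* Main.v *)
Require Import Defs.
From mathcomp Require Import all_boot all_order all_algebra.
From mathcomp Require Import all_classical all_reals all_analysis.
From mathcomp Require Import sesquilinear complex ring lra.
Set Implicit Arguments.
Unset Strict Implicit.
Unset Printing Implicit Defensive.
Import Order.TTheory GRing.Theory Num.Theory.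
Import numFieldNormedType.Exports.
Local Open Scope classical_set_scope.
Local Open Scope complex_scope.
Local Open Scope ring_scope.

(* For a unit vector (x, y), put c = |x|_A and d = |y|_A, so c^2 + d^2 = 1.  The
   triangle and Cauchy-Schwarz inequalities for the A-seminorm bound the square
   of the quantity defining dw by (c + b d)^2 (c^2 + (c + b d)^2), with
   b = |X|_A; taking x parallel to X y, with |X y|_A close to b |y|_A, shows that
   this bound is sharp.  It remains to maximise it for c = cos t, d = sin t.  At
   a maximum over the circle the derivative vanishes, which makes tan t a root of
   a cubic; the discriminant s is positive, so Cardano's formula gives the only
   real root, tan theta0, and that root is positive. *)

(** * Real cubics and Cardano's formula *)

Section Cubic.
Variable R : realType.
Implicit Types x y P Q s : R.

Lemma expr3_inj : injective (fun x : R => x ^+ 3).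
Proof.
move=> x y /= xy; apply/eqP; rewrite -subr_eq0; apply/eqP.
have : (x - y) * ((x + y / 2) ^+ 2 + 3 / 4 * y ^+ 2) = 0.
  by transitivity (x ^+ 3 - y ^+ 3); [field | rewrite xy subrr].
move/eqP; rewrite mulf_eq0 => /orP[/eqP //|].
have y_ge0 : 0 <= 3 / 4 * y ^+ 2 by rewrite mulr_ge0 ?sqr_ge0//; lra.
rewrite paddr_eq0 ?sqr_ge0// sqrf_eq0 => /andP[/eqP xy0 /eqP yy0].
have /eqP : y ^+ 2 = 0 by lra.
by rewrite sqrf_eq0 => /eqP y0; lra.
Qed.

Lemma cubic_factor P Q x y : x ^+ 3 + P * x + Q = 0 ->
  y ^+ 3 + P * y + Q = (y - x) * (y ^+ 2 + x * y + x ^+ 2 + P).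
Proof. by move=> x0; rewrite -[LHS]subr0 -x0; ring. Qed.

Section Cardano.
Variables P Q : R.
Let s := (Q / 2) ^+ 2 + (P / 3) ^+ 3.
Let y0 := cbrt (- (Q / 2) + Num.sqrt s) + cbrt (- (Q / 2) - Num.sqrt s).
Hypothesis s_gt0 : 0 < s.

(** Both sides have the same cube, since (Q/2)^2 - s = -(P/3)^3, and cubing is injective on the
    reals. *)
Lemma cardano_prod :
  cbrt (- (Q / 2) + Num.sqrt s) * cbrt (- (Q / 2) - Num.sqrt s) = - (P / 3).
Proof.
apply: expr3_inj => /=; rewrite exprMn !cbrtK.
rewrite mulrC -subr_sqr sqr_sqrtr ?ltW// /s; ring.
Qed.

Lemma cardano_root : y0 ^+ 3 + P * y0 + Q = 0.
Proof.
have beta3 := cbrtK (- (Q / 2) + Num.sqrt s).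
have gamma3 := cbrtK (- (Q / 2) - Num.sqrt s).
have := cardano_prod; rewrite /y0.
move: (cbrt _) (cbrt _) beta3 gamma3 => v u u3 v3 uv.
have -> : P = - 3 * (u * v) by rewrite uv; field.
by transitivity (u ^+ 3 + v ^+ 3 + Q); [ring | rewrite u3 v3; field].
Qed.

(** With y0 = u + v the sum of the two cube roots, P = -3uv turns the cofactor into (y + (u+v)/2)^2
    + 3/4 (u-v)^2, and s > 0 makes u and v distinct. Hence y0 is the only real root. *)
Lemma cardano_cofactor_gt0 y : 0 < y ^+ 2 + y0 * y + y0 ^+ 2 + P.
Proof.
have beta3 := cbrtK (- (Q / 2) + Num.sqrt s).
have gamma3 := cbrtK (- (Q / 2) - Num.sqrt s).
have := cardano_prod; rewrite /y0.
move: (cbrt _) (cbrt _) beta3 gamma3 => v u u3 v3 uv.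
have -> : P = - 3 * (u * v) by rewrite uv; field.
have uNv : u - v != 0.
  rewrite subr_eq0; apply/eqP => e.
  have := s_gt0; rewrite -sqrtr_gt0; move: u3; rewrite e v3; lra.
rewrite [ltRHS](_ : _ = (y + (u + v) / 2) ^+ 2 + 3 / 4 * (u - v) ^+ 2); last by field.
apply: ltr_wpDl; first exact: sqr_ge0.
by rewrite mulr_gt0 ?exprn_even_gt0 ?uNv ?orbT//; lra.
Qed.

End Cardano.
End Cubic.

(** * The bound to be maximised and its critical points on the unit circle *)

Definition quartic (R : realType) (b c d : R) : R :=
  (c + b * d) ^+ 2 * (c ^+ 2 + (c + b * d) ^+ 2).

Section Profile.
Variables (R : realType) (b : R).
Hypothesis b_gt0 : 0 < b.
Implicit Types t x : R.

Definition profile x : R := quartic b (cos x) (sin x).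

Definition profile' x : R := 2 * (cos x + b * sin x) *
  ((b * cos x - sin x) * (cos x ^+ 2 + (cos x + b * sin x) ^+ 2)
   + (cos x + b * sin x) *
     ((cos x + b * sin x) * (b * cos x - sin x) - cos x * sin x)).

Lemma is_derive_profile x : is_derive x 1 profile (profile' x).
Proof.
have -> : profile = (cos + b *: sin) ^+ 2 * (cos ^+ 2 + (cos + b *: sin) ^+ 2).
  by apply/funext => y; rewrite /profile /quartic !fctE.
have aux (c m : R -> R) (dc dm : R) : is_derive x 1 c dc -> is_derive x 1 m dm ->
    is_derive x 1 (m ^+ 2 * (c ^+ 2 + m ^+ 2))
      (2 * m x * (dm * (c x ^+ 2 + m x ^+ 2) + m x * (m x * dm + c x * dc))).
  move=> hc hm; apply: (is_derive_eq
    (is_deriveM (is_deriveX 2 hm) (is_deriveD (is_deriveX 2 hc) (is_deriveX 2 hm)))).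
  rewrite !fctE /GRing.scale /= !expr1; ring.
apply: (is_derive_eq (aux _ _ _ _ (is_derive_cos x)
  (is_deriveD (is_derive_cos x) (is_deriveZ b (is_derive_sin x))))).
by rewrite /profile' !fctE /= -[b *: sin x]/(b * sin x) -[b *: cos x]/(b * cos x); ring.
Qed.

(** Dependence on tan x alone lets a maximiser be exchanged for any angle with the same tangent. *)
Lemma profile_tan x : cos x != 0 ->
  profile x = (1 + b * tan x) ^+ 2 * (1 + (1 + b * tan x) ^+ 2) / (1 + tan x ^+ 2) ^+ 2.
Proof.
move=> c0.
have d0 : 1 + tan x ^+ 2 != 0 by rewrite gt_eqF// ltr_pwDl// sqr_ge0.
have -> : 1 + tan x ^+ 2 = cos x ^- 2 by rewrite cos2_tan2.
by rewrite /profile /quartic /tan; field.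
Qed.

(** The critical-point equation in t = tan x, made monic: when cos x is nonzero, [profile' x] is -4
    b^2 (cos x + b sin x) (cos x)^3 times [cubic (tan x)]. *)
Let cubic t := t ^+ 3 - (2 * b ^+ 2 - 5) / (2 * b) * t ^+ 2
  - (2 * b ^+ 2 - 2) / b ^+ 2 * t - 3 / (2 * b).

(** The extreme value theorem gives a maximum, which can be taken in the open interval; the
    derivative vanishes there while its factors other than the cubic do not. *)
Lemma profile_max : exists2 x0, cos x0 != 0 /\ cubic (tan x0) = 0 &
  forall x, - pi <= x <= pi -> profile x <= profile x0.
Proof.
have pi_gt0 := pi_gt0 R.
have le_pi : - pi <= pi :> R by lra.
have [|z] := @EVT_max R profile _ _ le_pi.
  apply: derivable_within_continuous => x _.
  by case: (is_derive_profile x).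
move=> zpi zmax.
have [x0 x0pi x0max] : exists2 x0, x0 \in `](- pi), pi[%R &
    forall x, x \in `[- pi, pi]%R -> profile x <= profile x0.
  have [zlt|] := boolP (z \in `](- pi), pi[%R); first by exists z.
  rewrite !in_itv /= in zpi *; move=> zN.
  (* [profile] has period pi, so a maximum at an end point is also one at 0. *)
  exists 0; first by rewrite in_itv /=; lra.
  suff -> : profile 0 = profile z by [].
  have [->|->] : z = - pi \/ z = pi by move: zN; case: ltgtP; case: ltgtP; lra.
    by rewrite /profile /quartic cosN sinN cospi sinpi cos0 sin0; ring.
  by rewrite /profile /quartic cospi sinpi cos0 sin0; ring.
have d0 : profile' x0 = 0.
  have [|||_ <-] := @derive1_at_max R profile (- pi) pi x0 le_pi.
  - by move=> t _; case: (is_derive_profile t).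
  - by [].
  - by move=> t tpi; apply: x0max; apply: subset_itv_oo_cc.
  by have [_ ->] := is_derive_profile x0.
(* Otherwise the maximum would be 0, whereas [profile] takes the value 2 at 0. *)
have m0 : cos x0 + b * sin x0 != 0.
  apply: contraTneq (x0max 0 _) => [m0|]; last by rewrite in_itv /=; lra.
  by rewrite /profile /quartic m0 cos0 sin0; lra.
(* If cos x0 = 0, the derivative reduces to -4 b^3 (sin x0)^4, which is nonzero. *)
have c0 : cos x0 != 0.
  apply: contra_eq_neq d0 => c0; move: m0; rewrite /profile' c0.
  have := cos2Dsin2 x0; rewrite c0 => s1.
  have s0 : sin x0 != 0.
    by apply: contra_eq_neq s1 => ->; rewrite expr0n /= addr0 eq_sym oner_eq0.
  move=> _; rewrite [X in X != _](_ : _ = - 4 * b ^+ 3 * sin x0 ^+ 4); last by ring.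
  by rewrite !mulf_neq0 ?expf_neq0 ?oppr_eq0 ?pnatr_eq0// gt_eqF.
exists x0; last by move=> x xpi; apply: x0max; rewrite in_itv.
split=> //.
have k0 : - 4 * b ^+ 2 * (cos x0 + b * sin x0) * cos x0 ^+ 3 != 0.
  by rewrite !mulf_neq0 ?expf_neq0 ?oppr_eq0 ?pnatr_eq0// gt_eqF.
apply: (mulfI k0); rewrite mulr0 -{}d0 /profile' /cubic /tan.
by field; rewrite c0 gt_eqF.
Qed.
End Profile.

(** * The maximising angle given by Cardano's formula *)

Section Maximizer.
Variables (R : realType) (b : R).
Hypothesis b_gt0 : 0 < b.

Let p := - ((2 * b ^+ 2 - 5) / (2 * b)).
Let q := - ((2 * b ^+ 2 - 2) / b ^+ 2).
Let r := - (3 / (2 * b)).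
Let s := (2 ^+ 4 * 3 ^+ 3 * b ^+ 6)^-1 *
  (8 * b ^+ 8 + 20 * b ^+ 6 + 45 * b ^+ 4 + 61 * b ^+ 2 + 28).
Let alpha := 27^-1 * (2 * p ^+ 3 - 9 * p * q + 27 * r).
Let beta := cbrt (- (alpha / 2) + Num.sqrt s).
Let gamma := cbrt (- (alpha / 2) - Num.sqrt s).
Let t0 := beta + gamma - p / 3.

(** The substitution t = y - p/3 gives the depressed cubic y^3 + (q - p^2/3) y + alpha, so [s] is
    the quantity under the square root in Cardano's formula. *)
Lemma s_discriminant : s = (alpha / 2) ^+ 2 + ((q - p ^+ 2 / 3) / 3) ^+ 3.
Proof.
have b0 : b != 0 by rewrite gt_eqF.
by rewrite /s /alpha /p /q /r; field.
Qed.

Lemma s_gt0 : 0 < s.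
Proof.
rewrite /s mulr_gt0 ?invr_gt0 ?mulr_gt0 ?exprn_gt0//.
have := exprn_gt0 8 b_gt0; have := exprn_gt0 6 b_gt0.
have := exprn_gt0 4 b_gt0; have := exprn_gt0 2 b_gt0; lra.
Qed.

(** The cofactor of the depressed cubic, taken at t + p/3, serves as w. This identifies the tangent
    of a maximiser with [t0] and also locates [t0] from the sign of the cubic at one point. *)
Lemma cubic_sign t : exists2 w, 0 < w &
  t ^+ 3 + p * t ^+ 2 + q * t + r = (t - t0) * w.
Proof.
pose P := q - p ^+ 2 / 3.
have D_gt0 : 0 < (alpha / 2) ^+ 2 + (P / 3) ^+ 3 by rewrite -s_discriminant s_gt0.
have root0 := cardano_root D_gt0; have w_gt0 := cardano_cofactor_gt0 D_gt0 (t + p / 3).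
move: root0 w_gt0; rewrite -s_discriminant -/beta -/gamma => root0 w_gt0.
eexists; first exact: w_gt0.
rewrite -[t - t0](_ : t + p / 3 - (beta + gamma) = _); last by rewrite /t0; ring.
by rewrite -(cubic_factor _ root0) /P /alpha; field.
Qed.

(** At 0 the cubic equals r < 0, so 0 lies to the left of its root. *)
Lemma t0_gt0 : 0 < t0.
Proof.
have [w w_gt0 e] := cubic_sign 0; rewrite -(pmulr_lgt0 _ w_gt0).
have -> : t0 * w = - r by rewrite -[LHS]opprK -mulNr -[- t0]add0r -e; ring.
by rewrite opprK divr_gt0// mulr_gt0.
Qed.

(** A maximiser has tangent [t0]; it need not be [atan t0] itself, but [profile_tan] shows that both
    angles give the same value. *)
Lemma profile_le_atan x : 0 <= x <= pi -> profile b x <= profile b (atan t0).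
Proof.
move=> /andP[x0 xpi]; have [x1 [cx1 root1] x1max] := profile_max b_gt0.
have x1t0 : tan x1 = t0.
  have [w w_gt0 e] := cubic_sign (tan x1).
  apply/eqP; rewrite -subr_eq0 -(mulIr_eq0 _ (mulIf (lt0r_neq0 w_gt0))) -e /p /q /r.
  by rewrite -[X in _ == X]root1; apply/eqP; ring.
apply: le_trans (x1max x _) _; first by have := pi_gt0 R; lra.
rewrite !profile_tan ?atanK ?x1t0// cos_atan invr_neq0// gt_eqF//.
by rewrite sqrtr_gt0 ltr_pwDl ?sqr_ge0.
Qed.

Lemma cos_atan_gt0 (x : R) : 0 < cos (atan x).
Proof. by rewrite cos_atan invr_gt0 sqrtr_gt0 ltr_pwDl ?sqr_ge0. Qed.

Lemma sin_atan_t0_gt0 : 0 < sin (atan t0).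
Proof.
have := t0_gt0; rewrite -[X in 0 < X]atanK /tan.
by rewrite pmulr_lgt0// invr_gt0 cos_atan_gt0.
Qed.

Lemma quartic_le c d : 0 <= c -> 0 <= d -> c ^+ 2 + d ^+ 2 = 1 ->
  quartic b c d <= profile b (atan t0).
Proof.
move=> c0 d0 cd1; have c1 : c <= 1.
  by rewrite -(@ler_pXn2r _ 2)// ?nnegrE// expr1n -cd1 lerDl sqr_ge0.
have hc : -1 <= c <= 1 by lra.
have := @profile_le_atan (acos c); rewrite acos_ge0 ?acos_lepi// => /(_ isT).
rewrite /profile acosK ?in_itv//= sin_acos// (_ : 1 - c ^+ 2 = d ^+ 2); last lra.
by rewrite sqrtr_sqr ger0_norm.
Qed.

End Maximizer.

(** * The semi-inner product of a positive operator *)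

Section SemiInner.
Variables (R : realType) (H : hilbertType R) (A : bop H).
Hypothesis A_psd : positive_semidefinite A.
Implicit Types (x y z : H) (a k : R) (l : R[i]).

Lemma innerADl x y z : innerA A (x + y) z = innerA A x z + innerA A y z.
Proof. by rewrite /innerA linearD linearDl. Qed.

Lemma innerADr x y z : innerA A x (y + z) = innerA A x y + innerA A x z.
Proof. by rewrite /innerA linearDr. Qed.

Lemma innerAZl l x y : innerA A (l *: x) y = l * innerA A x y.
Proof. by rewrite /innerA linearZ linearZl_LR. Qed.

Lemma innerAZr l x y : innerA A x (l *: y) = Num.conj l * innerA A x y.
Proof. by rewrite /innerA linearZr_LR. Qed.

(* Polarization: [innerA] takes real values on [x + y] and on [x + 'i y]. *)
Lemma innerAC x y : innerA A y x = Num.conj (innerA A x y).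
Proof.
have im0 z : complex.Im (innerA A z z) = 0 by apply/ger0_Im/A_psd.
have := im0 (x + y); have := im0 (x + 'i *: y).
rewrite !innerADl !innerADr !innerAZl !innerAZr.
move: (im0 x) (im0 y).
move: (innerA A x x) (innerA A x y) (innerA A y x) (innerA A y y).
move=> [a a'] [b b'] [c c'] [d d'] /= -> -> e1 e2; rewrite -[Num.conj _]/(b -i* b').
by congr (_ +i* _); lra.
Qed.

Lemma normA_sqr x : (normA A x ^+ 2)%:C = innerA A x x.
Proof.
have x_ge0 : 0 <= innerA A x x by exact: A_psd.
rewrite sqr_sqrtr ?RRe_real ?ger0_real//.
by move: x_ge0; rewrite lecE => /andP[].
Qed.

Lemma normAZ k x : normA A (k%:C *: x) = `|k| * normA A x.
Proof.
rewrite -sqrtr_sqr -sqrtrM ?sqr_ge0//; congr Num.sqrt.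
rewrite innerAZl innerAZr -normA_sqr -[Num.conj _]/(conjc _) conjc_real.
by rewrite mulrA -!rmorphM /= expr2.
Qed.

Lemma normA0 : normA A 0 = 0.
Proof. by rewrite /normA /innerA (linear0 A) linear0l sqrtr0. Qed.

(** The quadratic is the squared A-seminorm of x - t z y, with z the semi-inner product of x and y,
    k its modulus, and a, d the seminorms of x, y. Scaling by z avoids dividing by its modulus. *)
Lemma le_mul_of_quadratic_ge0 (a d k : R) : 0 <= a -> 0 <= d ->
  (forall t, 0 <= a ^+ 2 - 2 * t * k ^+ 2 + t ^+ 2 * k ^+ 2 * d ^+ 2) ->
  k <= a * d.
Proof.
move=> a_ge0 d_ge0 h; rewrite leNgt; apply/negP => adk.
have k_gt0 : 0 < k by rewrite (le_lt_trans _ adk) ?mulr_ge0.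
have [d0|d_neq0] := eqVneq d 0.
  (* For d = 0 the expression is affine in t; this t makes it equal to -1. *)
  have := h ((a ^+ 2 + 1) / (2 * k ^+ 2)); rewrite d0.
  have -> : 2 * ((a ^+ 2 + 1) / (2 * k ^+ 2)) * k ^+ 2 = a ^+ 2 + 1.
    by field; rewrite gt_eqF.
  rewrite expr0n /= mulr0; lra.
(* The minimiser of the quadratic in t. *)
have := h (d ^- 2).
have -> : a ^+ 2 - 2 * d ^- 2 * k ^+ 2 + (d ^- 2) ^+ 2 * k ^+ 2 * d ^+ 2 =
  ((a * d) ^+ 2 - k ^+ 2) / d ^+ 2 by field.
rewrite pmulr_lge0 ?invr_gt0 ?exprn_even_gt0//= subr_ge0 ler_sqr ?nnegrE;
  rewrite ?mulr_ge0 ?(ltW k_gt0)//.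
by rewrite leNgt adk.
Qed.

Lemma normr_Re l : `|l| = (complex.Re `|l|)%:C.
Proof. by rewrite RRe_real ?ger0_real. Qed.

Lemma semi_CauchySchwarz x y : complex.Re `|innerA A x y| <= normA A x * normA A y.
Proof.
apply: le_mul_of_quadratic_ge0; rewrite ?sqrtr_ge0// => t.
set z := innerA A x y; set k := complex.Re _.
(* The quadratic in t is the positive number <x - t z y, x - t z y>_A. *)
pose l := - (t%:C * z).
have := A_psd (x + l *: y); rewrite -/(innerA A _ _).
rewrite innerADl !innerADr !innerAZl !innerAZr (innerAC x y) -!normA_sqr -/z.
have zJ : z * Num.conj z = (k ^+ 2)%:C by rewrite -normCK normr_Re rmorphXn.
have -> : Num.conj l = - (t%:C * Num.conj z).
  by rewrite rmorphN rmorphM; congr (- (_ * _)); exact: conjc_real.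
rewrite -ler0c; congr (0 <= _).
have -> (a d K u : R) : (a - 2 * u * K + u ^+ 2 * K * d)%:C =
    a%:C - 2 * u%:C * K%:C + u%:C ^+ 2 * K%:C * d%:C.
  by rewrite !(rmorphD, rmorphN, rmorphM, rmorphXn, rmorph_nat).
by rewrite -zJ /l; ring.
Qed.

Lemma normA_triangle x y : normA A (x + y) <= normA A x + normA A y.
Proof.
rewrite -ler_sqr ?nnegrE ?addr_ge0 ?sqrtr_ge0//.
have -> : normA A (x + y) ^+ 2 =
    normA A x ^+ 2 + 2 * complex.Re (innerA A x y) + normA A y ^+ 2.
  apply: complexI; rewrite normA_sqr innerADl !innerADr (innerAC x y).
  have -> : Num.conj (innerA A x y) =
      (2 * complex.Re (innerA A x y))%:C - innerA A x y.
    by rewrite rmorphM rmorph_nat -addcJ addrC addKr.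
  by rewrite !rmorphD /= !normA_sqr; ring.
rewrite sqrrD lerD2r lerD2l -[leRHS]mulr_natl ler_wpM2l//.
apply: le_trans (semi_CauchySchwarz x y); apply: le_trans (ler_norm _) _.
by rewrite -lecR -normr_Re normc_ge_Re.
Qed.

(** Cauchy-Schwarz for x and A x bounds the squared norm of A x by the product of their seminorms,
    so A x nonzero forces x to have nonzero seminorm. This makes the sets under the suprema
    nonempty. *)
Lemma exists_unit : (exists x, A x != 0) -> exists x, normA A x = 1.
Proof.
move=> [x Ax0]; suff Nx0 : normA A x != 0.
  exists ((normA A x)^-1%:C *: x).
  by rewrite normAZ ger0_norm ?invr_ge0 ?sqrtr_ge0// mulVf.
apply: contra_neq Ax0 => Nx0; have := semi_CauchySchwarz x (A x).
rewrite Nx0 mul0r /innerA -norm_inner => h.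
apply/eqP; rewrite -normr_eq0 -sqrf_eq0 -normr_le0.
by rewrite normr_Re -[0]/(0%:C) lecR.
Qed.
End SemiInner.

(** * Upper and lower bounds for the block operator *)

Section Block.
Variables (R : realType) (H : hilbertType R) (A X : bop H).
Hypothesis A_neq0 : exists x, A x != 0.
Hypothesis A_psd : positive_semidefinite A.
Hypothesis X_bounded : A_bounded A X.
Let AA : bop (H ⊕ H) := block A bop0 bop0 A.
Let TT : bop (H ⊕ H) := block bop1 X bop0 bop0.
Let b := opnormA A X.
Implicit Types (x y : H) (u : H ⊕ H) (c d k V : R).

Let unitA_neq0 : [set x | normA A x = 1] !=set0.
Proof. exact: exists_unit. Qed.

Lemma opnormA_ub : has_ubound [set normA A (X x) | x in [set x | normA A x = 1]].
Proof.
have [k _ Xk] := X_bounded; exists k => _ [x /= x1 <-].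
by have := Xk x; rewrite x1 mulr1.
Qed.

Lemma opnormA_ge0 : 0 <= b.
Proof.
have [x x1] := unitA_neq0.
apply: le_trans (sqrtr_ge0 _) (ub_le_sup opnormA_ub _); by exists x.
Qed.

Lemma normA_le_opnormA x : normA A (X x) <= b * normA A x.
Proof.
have [Nx0|Nx0] := eqVneq (normA A x) 0.
  (* A null vector cannot be normalised; A-boundedness directly makes its image null. *)
  by have [k _ /(_ x)] := X_bounded; rewrite Nx0 !mulr0.
have Nx_gt0 : 0 < normA A x by rewrite lt0r Nx0 sqrtr_ge0.
rewrite -ler_pdivrMr// mulrC -[X in X * _](@ger0_norm _ (normA A x)^-1) ?invr_ge0 ?sqrtr_ge0//.
rewrite -normAZ// -linearZ; apply: (ub_le_sup opnormA_ub); eexists; last by [].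
by rewrite /= normAZ// ger0_norm ?invr_ge0 ?sqrtr_ge0// mulVf.
Qed.

Lemma innerA_diag u v : innerA AA u v = innerA A u.1 v.1 + innerA A u.2 v.2.
Proof. by rewrite /innerA hsum_innerE blockE /= addr0 add0r. Qed.

Lemma normA_diag u : normA AA u = Num.sqrt (normA A u.1 ^+ 2 + normA A u.2 ^+ 2).
Proof.
congr Num.sqrt; apply: complexI; rewrite rmorphD /= !normA_sqr//.
rewrite -innerA_diag RRe_real// ger0_real// innerA_diag.
by rewrite addr_ge0 ?A_psd//; exact: A_psd.
Qed.

Lemma normA_TT u : normA AA (TT u) = normA A (u.1 + X u.2).
Proof.
rewrite normA_diag blockE /= addr0.
by rewrite normA0 expr0n addr0 sqrtr_sqr ger0_norm ?sqrtr_ge0.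
Qed.

Lemma innerA_TT u : innerA AA (TT u) u = innerA A (u.1 + X u.2) u.1.
Proof. by rewrite innerA_diag blockE /= addr0 /innerA (linear0 A) linear0l addr0. Qed.

Definition dw_value u := Num.sqrt
  (complex.Re `|innerA AA (TT u) u| ^+ 2 + normA AA (TT u) ^+ 4).

Lemma dw_value_le u :
  dw_value u <= Num.sqrt (quartic b (normA A u.1) (normA A u.2)).
Proof.
have b_ge0 := opnormA_ge0.
rewrite ler_wsqrtr// /dw_value innerA_TT normA_TT /quartic.
set c := normA A u.1; set d := normA A u.2; set m := normA A _.
have [c_ge0 d_ge0 m_ge0] : [/\ 0 <= c, 0 <= d & 0 <= m] by rewrite !sqrtr_ge0.
have m_le : m <= c + b * d.
  apply: le_trans (normA_triangle A_psd _ _) _.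
  by rewrite lerD2l normA_le_opnormA.
(* The bound splits as ((c + b d) c)^2 + (c + b d)^4, which is compared term by term. *)
rewrite mulrDr -exprMn -exprD; apply: lerD; last first.
  by rewrite lerXn2r ?nnegrE ?addr_ge0 ?mulr_ge0.
have k_le := semi_CauchySchwarz A_psd (u.1 + X u.2) u.1.
rewrite lerXn2r ?nnegrE ?mulr_ge0 ?addr_ge0 ?mulr_ge0//.
  by rewrite -ler0c -normr_Re.
by apply: le_trans k_le _; rewrite ler_wpM2r.
Qed.

Lemma unit_diag u : normA AA u = 1 -> normA A u.1 ^+ 2 + normA A u.2 ^+ 2 = 1.
Proof.
rewrite normA_diag => /(congr1 (fun k => k ^+ 2)).
by rewrite sqr_sqrtr ?addr_ge0 ?sqr_ge0// expr1n.
Qed.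

Lemma dw_TT_le V :
  (forall c d, 0 <= c -> 0 <= d -> c ^+ 2 + d ^+ 2 = 1 -> quartic b c d <= V) ->
  dw AA TT <= Num.sqrt V.
Proof.
move=> QV; apply: ge_sup.
  have [x x1] := unitA_neq0; eexists; exists (x, 0); last by [].
  rewrite /= normA_diag /= x1.
  by rewrite normA0 expr0n addr0 expr1n sqrtr1.
move=> _ [u /= u1 <-]; apply: le_trans (dw_value_le u) _.
by rewrite ler_wsqrtr// QV ?sqrtr_ge0// unit_diag.
Qed.

Lemma dw_value_le_dw u : normA AA u = 1 -> dw_value u <= dw AA TT.
Proof.
move=> u1; apply: ub_le_sup; last by exists u.
(* A crude bound from c, d <= 1; it only ensures that the supremum is a genuine one. *)
exists (Num.sqrt ((1 + b) ^+ 2 * (1 + (1 + b) ^+ 2))) => _ [v /= /unit_diag v1 <-].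
apply: le_trans (dw_value_le v) _; rewrite ler_wsqrtr// /quartic.
have b_ge0 := opnormA_ge0.
have [c_ge0 d_ge0] : 0 <= normA A v.1 /\ 0 <= normA A v.2 by rewrite !sqrtr_ge0.
move: (normA A v.1) (normA A v.2) c_ge0 d_ge0 v1 => c d c_ge0 d_ge0 cd1.
have c2 : c ^+ 2 <= 1 by rewrite -cd1 lerDl sqr_ge0.
have d2 : d ^+ 2 <= 1 by rewrite -cd1 lerDr sqr_ge0.
have c1 : c <= 1 by rewrite -(@ler_pXn2r _ 2)// ?nnegrE// expr1n.
have d1 : d <= 1 by rewrite -(@ler_pXn2r _ 2)// ?nnegrE// expr1n.
have m_le : (c + b * d) ^+ 2 <= (1 + b) ^+ 2.
  by rewrite lerXn2r ?nnegrE ?addr_ge0 ?mulr_ge0// lerD// ler_piMr.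
by rewrite ler_pM ?addr_ge0 ?sqr_ge0// lerD.
Qed.

Lemma quartic_le_dw_image c d y : 0 <= c -> 0 <= d -> c ^+ 2 + d ^+ 2 = 1 ->
  normA A y = 1 -> Num.sqrt (quartic (normA A (X y)) c d) <= dw AA TT.
Proof.
move=> c_ge0 d_ge0 cd1 y1; set k := normA A (X y).
have [k0|k0] := eqVneq k 0.
  (* When X y is null, the test vector (y, 0) yields sqrt 2, while the quartic is 2 c^4 <= 2. *)
  have /dw_value_le_dw : normA AA (y, 0) = 1.
    rewrite normA_diag /= y1.
    by rewrite normA0 expr0n addr0 expr1n sqrtr1.
  apply: le_trans; rewrite /dw_value innerA_TT normA_TT.
  rewrite (_ : _ + _ = y); last by rewrite /= (linear0 X) addr0.
  rewrite -[(y, 0).1]/y y1; have -> : complex.Re `|innerA A y y| = 1.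
    by rewrite -normA_sqr// y1 expr1n ger0_norm ?ler0c.
  rewrite !expr1n ler_wsqrtr// /quartic k0 mul0r addr0.
  have c2 : c ^+ 2 <= 1 by rewrite -cd1 lerDl sqr_ge0.
  have := sqr_ge0 c; nra.
have k_gt0 : 0 < k by rewrite lt0r k0 sqrtr_ge0.
(* The first component is parallel to X y and has seminorm c, so both the triangle and the
   Cauchy-Schwarz inequalities become equalities. *)
pose u : H ⊕ H := ((c / k)%:C *: X y, d%:C *: y).
have uE : u.1 + X u.2 = (c / k + d)%:C *: X y.
  by rewrite /u /= linearZ -scalerDl rmorphD.
have /dw_value_le_dw : normA AA u = 1.
  rewrite normA_diag /= !normAZ// -/k y1 !ger0_norm ?divr_ge0//; last exact: ltW.
  by rewrite divfK// mulr1 cd1 sqrtr1.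
apply: le_trans; rewrite ler_wsqrtr// innerA_TT normA_TT uE normAZ//.
rewrite innerAZl innerAZr -normA_sqr// -/k.
have -> : Num.conj (c / k)%:C = (c / k)%:C by exact: conjc_real.
have ck_ge0 : 0 <= c / k by rewrite divr_ge0// ltW.
have m_ge0 : 0 <= c / k + d by rewrite addr_ge0.
rewrite (ger0_norm m_ge0) -!rmorphM [X in complex.Re X]ger0_norm; last first.
  by rewrite ler0c mulr_ge0// mulr_ge0// sqr_ge0.
rewrite le_eqVlt; apply/orP; left; apply/eqP; rewrite /quartic /=.
by field.
Qed.

(** The supremum [b] need not be attained, but it lies in the closure of the values of the seminorm
    of X y. The inequality holds at those values and is a closed condition, by continuity of the
    quartic in its first parameter. *)
Lemma quartic_le_dw c d : 0 <= c -> 0 <= d -> c ^+ 2 + d ^+ 2 = 1 ->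
  Num.sqrt (quartic b c d) <= dw AA TT.
Proof.
move=> c_ge0 d_ge0 cd1.
pose f k := Num.sqrt (quartic k c d).
have fcont : continuous f.
  move=> k; apply: continuous_comp; last exact: sqrt_continuous.
  have mcont : {for k, continuous (fun k => c + k * d)}.
    by apply: cvgD; [exact: cvg_cst|apply: cvgMl; exact: cvg_id].
  have m2cont : {for k, continuous (fun k => (c + k * d) ^+ 2)}.
    exact: (cvgM mcont mcont).
  exact: (cvgM m2cont (cvgD (cvg_cst _) m2cont)).
have /closure_id cl : closed (f @^-1` [set v | v <= dw AA TT]).
  by move/continuous_closedP: fcont; apply; exact: closed_le.
have : closure (f @^-1` [set v | v <= dw AA TT]) b.
  apply: (closureS _ (closure_sup _ opnormA_ub)).
    by move=> _ [y /= y1 <-]; exact: quartic_le_dw_image.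
  by have [y y1] := unitA_neq0; eexists; exists y.
by rewrite -cl.
Qed.
End Block.

Theorem theorem2p34 (R : realType) (H : hilbertType R) (A X : bop H)
    (A_neq0 : exists x, A x != 0) (A_psd : positive_semidefinite A)
    (X_bounded : A_bounded A X) :
  let AA : bop (H ⊕ H) := block A bop0 bop0 A in
  let TT : bop (H ⊕ H) := block bop1 X bop0 bop0 in
  let b : R := opnormA A X in
  let p := - ((2 * b ^+ 2 - 5) / (2 * b)) in
  let q := - ((2 * b ^+ 2 - 2) / b ^+ 2) in
  let r := - (3 / (2 * b)) in
  let s := (2 ^+ 4 * 3 ^+ 3 * b ^+ 6)^-1 *
    (8 * b ^+ 8 + 20 * b ^+ 6 + 45 * b ^+ 4 + 61 * b ^+ 2 + 28) in
  let alpha := 27^-1 * (2 * p ^+ 3 - 9 * p * q + 27 * r) in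
  let beta := cbrt (- (alpha / 2) + Num.sqrt s) in
  let gamma := cbrt (- (alpha / 2) - Num.sqrt s) in
  let theta0 := atan (beta + gamma - p / 3) in
  dw AA TT =
    if b == 0 then Num.sqrt 2
    else (cos theta0 + b * sin theta0) *
         Num.sqrt (cos theta0 ^+ 2 + (cos theta0 + b * sin theta0) ^+ 2).
Proof.
move=> AA TT b p q r s alpha beta gamma theta0.
have [b0|b_neq0] := eqVneq b 0.
  apply/eqP; rewrite eq_le; apply/andP; split.
    apply: dw_TT_le => // c d c_ge0 d_ge0 cd1.
    have c2 : c ^+ 2 <= 1 by rewrite -cd1 lerDl sqr_ge0.
    by rewrite -/b b0 /quartic mul0r addr0; have := sqr_ge0 c; nra.
  have := @quartic_le_dw R H A X A_neq0 A_psd X_bounded 1 0.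
  rewrite -/b b0 /quartic mul0r addr0 !expr1n mul1r expr0n addr0.
  exact.
have b_gt0 : 0 < b by rewrite lt0r b_neq0 opnormA_ge0.
have cos_gt0 : 0 < cos theta0 by exact: cos_atan_gt0.
have sin_gt0 : 0 < sin theta0 by exact: sin_atan_t0_gt0.
have m_ge0 : 0 <= cos theta0 + b * sin theta0.
  by rewrite addr_ge0 ?mulr_ge0// ltW.
(* Moving the nonnegative factor under the root makes the right-hand side the square root of
   [quartic b (cos theta0) (sin theta0)]. *)
rewrite -{1}(ger0_norm m_ge0) -sqrtr_sqr -sqrtrM ?sqr_ge0//.
apply/eqP; rewrite eq_le; apply/andP; split.
  by apply: dw_TT_le => // c d *; exact: quartic_le.
by apply: quartic_le_dw; rewrite ?ltW ?cos2Dsin2.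
Qed.
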